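(* Let $\mathbb K=\mathbb F_q$, let $H=\langle\eta\rangle$ be a submonoid of $\mathbb F_q^*$, let $a_1,\dots,a_r$ be integers, and let $Y=Y_{A,H}=\{[t_1^{a_1}:\cdots:t_r^{a_r}] : t_i\in H\}\subseteq T_X$. Let $d_i=|\eta^{a_i}|$ be the order of $\eta^{a_i}$. If $d_1,\dots,d_r$ are pairwise relatively prime, then the length of the generalized toric code $\mathcal C_{\alpha,Y}$ is $d_1\cdots d_r$.
   Context: Setting. $X$ is a complete simplicial toric variety over $\mathbb K=\mathbb F_q$ given by a fan $\Sigma\subset\mathbb R^n$ with rays $\rho_1,\dots,\rho_r$ and corresponding primitive lattice generators $\mathbf v_1,\dots,\mathbf v_r\in\mathbb Z^n$. The matrix $\phi:\mathbb Z^n\to\mathbb Z^r$ has rows $\mathbf v_1,\dots,\mathbf v_r$, and there is an exact sequence $0\to\mathbb Z^n\xrightarrow{\phi}\mathbb Z^r\xrightarrow{\beta}\mathcal A\to 0$ with $\mathcal A\cong \mathrm{Cl}(X)$, assumed torsion-free. The Cox ring $S=\mathbb K[x_1,\dots,x_r]=\bigoplus_{\alpha\in\mathcal A}S_\alpha$ is graded via $\deg x_j=\beta_j:=\beta(e_j)$. Let $\mathbf u_1,\dots,\mathbf u_n\in\mathbb Z^r$ be the columns of $\phi$, write $\mathbf t^{\mathbf u}=t_1^{u_1}\cdots t_r^{u_r}$, let $\pi:(\mathbb K^* )^r\to T_X\cong(\mathbb K^* )^n$, $\pi(\mathbf t)=(\mathbf t^{\mathbf u_1},\dots,\mathbf t^{\mathbf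 u_n})$, and $G=\ker\pi$; then $T_X=(\mathbb K^* )^r/G$, and $[P]=[p_1:\cdots:p_r]=G\cdot P$. Generalized toric code: let $Y=\{[P_1],\dots,[P_N]\}\subseteq T_X$ ($N$ distinct points), let $\alpha$ lie in the semigroup $\mathbb N\beta\subset\mathcal A$ generated by $\beta_1,\dots,\beta_r$, and fix a monomial $F_0\in S_\alpha$. The evaluation map is $\mathrm{ev}_Y:S_\alpha\to\mathbb F_q^N$, $F\mapsto\left(\frac{F(P_1)}{F_0(P_1)},\dots,\frac{F(P_N)}{F_0(P_N)}\right)$, and $\mathcal C_{\alpha,Y}=\mathrm{ev}_Y(S_\alpha)\subseteq\mathbb F_q^N$; its (block-)length is $N=|Y|$. *)

(* Defs.v *)
From HB Require Import structures.
From mathcomp Require Import all_boot all_order all_algebra all_fingroup.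
From mathcomp Require Import classical_sets cardinality reals.
From mathcomp Require Import mpoly.

Set Implicit Arguments.
Unset Strict Implicit.
Unset Printing Implicit Defensive.

Import Order.TTheory GRing.Theory Num.Theory.
Local Open Scope ring_scope.

Section Fans.
Context {R : realType} {n : nat}.
Local Open Scope classical_set_scope.

Implicit Types (sigma tau : set 'rV[R]_n) (Sigma : set (set 'rV[R]_n)).

(* The cone spanned by the rows of B. *)
Definition cone k (B : 'M[R]_(k, n)) : set 'rV[R]_n :=
  [set c *m B | c in [set c : 'rV[R]_k | forall i, 0 <= c 0 i]].

Definition of_lattice k (B : 'M[int]_(k, n)) : 'M[R]_(k, n) := map_mx intr B.

Definition rational_polyhedral sigma : Prop :=
  exists k (B : 'M[int]_(k, n)), sigma = cone (of_lattice B).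

Definition strongly_convex sigma : Prop :=
  forall x, sigma x -> sigma (- x) -> x = 0.

(* tau is cut out of sigma by a supporting hyperplane u = 0, where u is in the
   dual cone of sigma; u = 0 gives tau = sigma. *)
Definition is_face tau sigma : Prop :=
  exists u : 'cV[R]_n,
    (forall x, sigma x -> 0 <= (x *m u) 0 0) /\
    tau = sigma `&` [set x | x *m u = 0].

(* The linear span of sigma has dimension d: some d linearly independent
   elements of sigma span it. *)
Definition cone_dim sigma (d : nat) : Prop :=
  exists B : 'M[R]_(d, n),
    [/\ row_free B, forall i, sigma (row i B)
      & forall x, sigma x -> (x <= B)%MS].

Definition simplicial_cone sigma : Prop :=
  exists k (B : 'M[R]_(k, n)), row_free B /\ sigma = cone B.

Record is_fan Sigma : Prop := IsFan {
  fan_finite : finite_set Sigma;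
  fan_rational : forall sigma, Sigma sigma -> rational_polyhedral sigma;
  fan_strongly_convex : forall sigma, Sigma sigma -> strongly_convex sigma;
  fan_face : forall sigma tau, Sigma sigma -> is_face tau sigma -> Sigma tau;
  fan_inter : forall sigma tau, Sigma sigma -> Sigma tau ->
    is_face (sigma `&` tau) sigma /\ is_face (sigma `&` tau) tau }.

Definition simplicial_fan Sigma : Prop :=
  forall sigma, Sigma sigma -> simplicial_cone sigma.

Definition complete_fan Sigma : Prop :=
  \bigcup_(sigma in Sigma) sigma = [set: 'rV[R]_n].

Definition primitive (v : 'rV[int]_n) : Prop :=
  forall (k : int) (w : 'rV[int]_n), v = k *: w -> k \is a GRing.unit.

(* The rows of phi are the primitive lattice generators of the rays (the
   one-dimensional cones) of Sigma, each ray being listed exactly once. *)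
Record is_ray_matrix Sigma r (phi : 'M[int]_(r, n)) : Prop := IsRayMatrix {
  ray_primitive : forall i, primitive (row i phi);
  ray_inj : injective (fun i => cone (of_lattice (row i phi)));
  ray_cone : forall sigma, (Sigma sigma /\ cone_dim sigma 1) <->
    exists i, sigma = cone (of_lattice (row i phi)) }.

End Fans.

(* Exactness of 0 -> Z^n -> Z^r -> A -> 0. *)
Record class_exact n r (phi : 'M[int]_(r, n)) (A : zmodType)
    (beta : {additive 'cV[int]_r -> A}) : Prop := ClassExact {
  class_inj : injective (fun m : 'cV[int]_n => phi *m m);
  class_ker : forall x, beta x = 0 <-> exists m : 'cV[int]_n, x = phi *m m;
  class_surj : forall y : A, exists x, beta x = y }.

Definition torsion_free (A : zmodType) : Prop :=
  forall (x : A) (k : nat), (0 < k)%N -> x *+ k = 0 -> x = 0.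

Section Cox.
Context {r : nat} {A : zmodType}.
Variable beta : {additive 'cV[int]_r -> A}.

Definition var_deg (j : 'I_r) : A := beta (delta_mx j 0).

Definition in_semigroup (alpha : A) : Prop :=
  exists c : 'I_r -> nat, alpha = \sum_j var_deg j *+ c j.

Definition mon_deg (m : 'X_{1..r}) : A := \sum_j var_deg j *+ m j.

(* The graded piece S_alpha of S = K[x_1, ..., x_r]. *)
Definition cox_piece (K : fieldType) (alpha : A) : set {mpoly K[r]} :=
  [set F | forall m, m \in msupp F -> mon_deg m = alpha]%classic.

End Cox.
Arguments cox_piece {r A} beta K alpha.

Definition expzg (gT : finGroupType) (x : gT) (z : int) : gT :=
  match z with
  | Posz k => (x ^+ k)%g
  | Negz k => (x ^- k.+1)%g
  end.

(* (K^* )^r; the dependent form {dffun _} is the one which the library equips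
   with the product group structure. *)
Notation torus K r := {dffun forall _ : 'I_r, {unit K}}.

Section Torus.
Context {K : finFieldType}.

Fact unit_commute (x y : {unit K}) : commute x y.
Proof. by apply: val_inj; rewrite /= mulrC. Qed.

Fact expzgM (x y : {unit K}) z : expzg (x * y)%g z = (expzg x z * expzg y z)%g.
Proof.
by case: z => k /=; rewrite expgMn ?invMg; do ?exact: unit_commute.
Qed.

Context {n r : nat}.
Variable phi : 'M[int]_(r, n).

(* The j-th coordinate of pi t is t^(u_j), where u_j is the j-th column of phi. *)
Definition torus_pi (t : torus K r) : torus K n :=
  [ffun j => (\prod_i expzg (t i) (phi i j))%g].

Fact torus_piM : {in [set: torus K r]%SET &, {morph torus_pi : s t / (s * t)%g}}.
Proof.
move=> s t _ _; apply/ffunP => j; rewrite mulg_ffun !ffunE.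
elim/big_ind3: _ => [|a b c a' b' c' -> ->|i _]; first by rewrite mulg1.
- by rewrite !mulgA -(mulgA b a b') (unit_commute a b') !mulgA.
- by rewrite mulg_ffun expzgM.
Qed.
Canonical torus_pi_morphism := Morphism torus_piM.

Definition torus_G : {group torus K r} := 'ker torus_pi_morphism.

(* T_X = (K^* )^r / G, whose elements are the cosets G * P. *)
Definition toric_torus := coset_of torus_G.

Definition torus_class (P : torus K r) : toric_torus := coset torus_G P.

Fact torus_classE (P Q : torus K r) :
  torus_class P = torus_class Q <-> exists2 g, g \in torus_G & P = (g * Q)%g.
Proof.
have nG s : s \in 'N(torus_G)%g by rewrite (fintype.subsetP (ker_norm torus_pi_morphism)) ?inE.
rewrite /torus_class; split=> [PQ | [g Gg ->]].
  by have /(rcoset_kercosetP (nG P) (nG Q))/rcosetP[g Gg ->] := PQ; exists g.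
by rewrite coset_kerl.
Qed.

(* Y_{A,H}, the set of all [t_1^(a_1) : ... : t_r^(a_r)] with all t_i in H. *)
Definition parametrized_set (a : 'I_r -> int) (H : {set {unit K}}) :
    {set toric_torus} :=
  [set torus_class [ffun i => expzg (t i) (a i)]
     | t : torus K r & [forall i, t i \in H]]%SET.

End Torus.

Section Codes.
Context {K : finFieldType} {r : nat} {A : zmodType}.
Variable beta : {additive 'cV[int]_r -> A}.

Definition eval_at (F : {mpoly K[r]}) (P : torus K r) : K :=
  F.@[fun i => val (P i)].

Definition ev N (F0 : {mpoly K[r]}) (P : 'I_N -> torus K r)
    (F : {mpoly K[r]}) : 'rV[K]_N :=
  \row_k (eval_at F (P k) / eval_at F0 (P k)).

(* The code C_{alpha,Y} for Y = {[P_1], ..., [P_N]}. *)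
Definition toric_code N (alpha : A) (F0 : {mpoly K[r]})
    (P : 'I_N -> torus K r) : set 'rV[K]_N :=
  (ev F0 P @` cox_piece beta K alpha)%classic.

End Codes.

(* The length of a code C in K^N is the dimension N of its ambient space. *)
Definition code_length (K : fieldType) N (C : set 'rV[K]_N) : nat := N.

(* Main.v *)
Require Import Defs.
From mathcomp Require Import all_boot all_order all_algebra all_fingroup.
From mathcomp Require Import classical_sets reals.
From mathcomp Require Import mpoly.
From mathcomp Require Import cyclic.

(** The points P_k represent the elements of Y without repetition, so the
    length N is the cardinality of Y, and everything rests on counting Y.

    As t runs over H^r, the vector (t_1^(a_1), ..., t_r^(a_r)) runs over the
    subgroup B = <eta^(a_1)> x ... x <eta^(a_r)> of (K^* )^r, which has
    d_1 ... d_r elements ([parametrized_setE]).  Thus Y is the image of B in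
    (K^* )^r / G, and the claim amounts to B meeting G trivially
    ([torus_G_setXn_trivial]).

    Let s be in both.  For each column j of phi, the elements s_i^(phi_ij)
    multiply to 1, and their orders divide the pairwise coprime d_i, so each of
    them is 1 ([prodg_coprime_eq1]).  Hence the order of s_i divides every
    entry of the i-th ray generator, and that generator is a primitive lattice
    vector; so s_i = 1 ([primitive_expzg_eq1]). *)

Local Open Scope ring_scope.

Lemma expzgXn (gT : finGroupType) (x : gT) (k : nat) (z : int) :
  expzg (x ^+ k)%g z = (expzg x z ^+ k)%g.
Proof. by case: z => m /=; rewrite ?expgVn -!expgM mulnC. Qed.

Lemma expzg_eq1 (gT : finGroupType) (x : gT) (z : int) :
  (expzg x z == 1%g) = (#[x]%g %| `|z|)%N.
Proof. by case: z => m /=; rewrite ?eq_invg1 order_dvdn. Qed.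

Lemma expzg_in_group (gT : finGroupType) (G : {group gT}) (x : gT) (z : int) :
  x \in G -> expzg x z \in G.
Proof. by case: z => m Gx /=; rewrite ?groupV groupX. Qed.

(** Raising the product to the power of all the d_j with j different from i
    kills every factor but the i-th, and does so by an exponent prime to d_i. *)
Lemma prodg_coprime_eq1 (gT : finGroupType) (I : finType)
    (d : I -> nat) (x : I -> gT) :
  (forall y z : gT, commute y z) ->
  (forall i j, i != j -> coprime (d i) (d j)) ->
  (forall i, #[x i]%g %| d i)%N ->
  (\prod_i x i = 1)%g -> forall i, x i = 1%g.
Proof.
move=> comm co_d ord_x prod_x i.
pose D := (\prod_(j | j != i) d j)%N.
have co_iD : coprime (d i) D.
  rewrite /D; elim/big_ind: _ => [|m k|j ji]; first exact: coprimen1.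
    by rewrite coprimeMr => -> ->.
  by apply: co_d; rewrite eq_sym.
have expM : {morph (fun y : gT => y ^+ D)%g : y z / (y * z)%g}.
  by move=> y z; apply: expgMn; apply: comm.
have expD : ((\prod_j x j) ^+ D = \prod_j x j ^+ D)%g.
  exact: (big_morph _ expM (expg1n _ D)).
have xD : (x i ^+ D = 1)%g.
  have := expD; rewrite prod_x expg1n (@big_only1 _ _ _ _ i) // => j ji _.
  apply/eqP; rewrite -order_dvdn; apply: dvdn_trans (ord_x j) _.
  by rewrite /D (bigD1 j) //= dvdn_mulr.
apply/eqP; rewrite -order_eq1 -dvdn1 -(eqP co_iD) dvdn_gcd ord_x /=.
by rewrite order_dvdn xD.
Qed.

(** The order of x divides all entries of v, and a common divisor of the
    entries of a primitive vector is a unit. *)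
Lemma primitive_expzg_eq1 (gT : finGroupType) (n : nat) (v : 'rV[int]_n)
    (x : gT) :
  primitive v -> (forall j, expzg x (v 0 j) = 1%g) -> x = 1%g.
Proof.
move=> prim_v xv.
have v_mul : v = (#[x]%g : int) *: map_mx (divz^~ (#[x]%g : int)) v.
  apply/rowP => j; rewrite !mxE GRing.mulrC divzK //.
  by rewrite dvdzE absz_nat -expzg_eq1 xv.
have := prim_v _ _ v_mul.
by rewrite qualifE /= => /orP[/eqP[/eqP]|/eqP//]; rewrite order_eq1 => /eqP.
Qed.

(** Coprimality turns each equation prod_i s_i^(phi_ij) = 1 defining G into the
    separate equations s_i^(phi_ij) = 1, to which primitivity of the i-th ray
    generator applies. *)
Lemma torus_G_setXn_trivial (K : finFieldType) (n r : nat)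
    (phi : 'M[int]_(r, n)) (C : 'I_r -> {group {unit K}}) (s : torus K r) :
  (forall i, primitive (row i phi)) ->
  (forall i j, i != j -> coprime #|C i| #|C j|) ->
  s \in torus_G phi -> s \in setXn C -> s = 1%g.
Proof.
move=> prim_phi co_C /kerP; rewrite inE => /(_ isT) /= pi_s /setXnP Cs.
apply/ffunP => i; rewrite [RHS]ffunE.
apply: primitive_expzg_eq1 (prim_phi i) _ => j; rewrite mxE.
apply: (prodg_coprime_eq1 _ _ (fun k => #|C k|)
  (fun k => expzg (s k) (phi k j))) => //.
- exact: unit_commute.
- by move=> k; apply: order_dvdG; apply: expzg_in_group.
- by have /ffunP/(_ j) := pi_s; rewrite !ffunE.
Qed.

Lemma torus_class_inj_setXn (K : finFieldType) (n r : nat)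
    (phi : 'M[int]_(r, n)) (C : 'I_r -> {group {unit K}}) :
  (forall i, primitive (row i phi)) ->
  (forall i j, i != j -> coprime #|C i| #|C j|) ->
  {in setXn C &, injective (torus_class phi)}.
Proof.
move=> prim_phi co_C s t Cs Ct /torus_classE[g Gg def_s].
have Cg : g \in setXn C by rewrite -(groupMr _ Ct) -def_s.
by rewrite def_s (torus_G_setXn_trivial _ _ _ _ _ _ prim_phi co_C Gg Cg) mul1g.
Qed.

(** Writing t_i = eta^k gives t_i^(a_i) = (eta^(a_i))^k, so the a_i-th powers of
    elements of <eta> are exactly the elements of <eta^(a_i)>. *)
Lemma parametrized_setE (K : finFieldType) (n r : nat) (phi : 'M[int]_(r, n))
    (a : 'I_r -> int) (eta : {unit K}) :
  parametrized_set phi a <[eta]>%g =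
    [set torus_class phi s | s in setXn (fun i => <[expzg eta (a i)]>%g)]%SET.
Proof.
apply/setP => y; apply/imsetP/imsetP => [[t]|[s /setXnP s_cyc ->]].
  rewrite inE => /forallP t_cyc ->.
  exists [ffun i => expzg (t i) (a i)] => //; apply/setXnP => i.
  by have /cycleP[k tE] := t_cyc i; rewrite ffunE tE expzgXn mem_cycle.
have /fin_all_exists[k sE] i : exists k, s i = (expzg eta (a i) ^+ k)%g.
  exact/cycleP.
exists [ffun i => (eta ^+ k i)%g].
  by rewrite inE; apply/forallP => i; rewrite ffunE mem_cycle.
by congr torus_class; apply/ffunP => i; rewrite !ffunE expzgXn sE.
Qed.

Lemma card_parametrized_set (K : finFieldType) (n r : nat)
    (phi : 'M[int]_(r, n)) (a : 'I_r -> int) (eta : {unit K}) :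
  (forall i, primitive (row i phi)) ->
  (forall i j, i != j ->
    coprime #[expzg eta (a i)]%g #[expzg eta (a j)]%g) ->
  #|parametrized_set phi a <[eta]>%g| = (\prod_i #[expzg eta (a i)]%g)%N.
Proof.
move=> prim_phi co_d; rewrite parametrized_setE card_in_imset ?cardsXn //.
exact: (torus_class_inj_setXn _ _ _ _ (fun i => <[expzg eta (a i)]>%G)).
Qed.

Theorem corollary6p3
    (R : realType) (n r : nat)
    (Sigma : set (set 'rV[R]_n)) (phi : 'M[int]_(r, n))
    (fan_Sigma : is_fan Sigma)
    (simplicial_Sigma : simplicial_fan Sigma)
    (complete_Sigma : complete_fan Sigma)
    (rays_phi : is_ray_matrix Sigma phi)
    (A : zmodType) (beta : {additive 'cV[int]_r -> A})
    (exact_beta : class_exact phi beta)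
    (tf_A : torsion_free A)
    (K : finFieldType)
    (alpha : A) (alpha_semigroup : in_semigroup beta alpha)
    (m0 : 'X_{1..r}) (F0_alpha : cox_piece beta K alpha 'X_[m0])
    (eta : {unit K}) (H : {set {unit K}})
    (H_gen : forall x : {unit K}, x \in H <-> exists k : nat, x = (eta ^+ k)%g)
    (a : 'I_r -> int)
    (N : nat) (P : 'I_N -> torus K r)
    (P_distinct : injective (fun k => torus_class phi (P k)))
    (P_Y : [set torus_class phi (P k) | k : 'I_N]%SET = parametrized_set phi a H)
    (d_coprime : forall i j : 'I_r, i != j ->
       coprime #[expzg eta (a i)]%g #[expzg eta (a j)]%g) :
  code_length (toric_code beta alpha 'X_[m0] P) =
    (\prod_(i < r) #[expzg eta (a i)]%g)%N.
Proof.
have H_cycle : H = <[eta]>%g.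
  by apply/setP => x; apply/idP/cycleP => [/H_gen|/H_gen].
rewrite /code_length -(card_parametrized_set _ _ _ phi a eta) //.
  by rewrite -H_cycle -P_Y card_imset ?card_ord.
exact: ray_primitive rays_phi.
Qed.
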